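(* If $\mathfrak s$ is a $6$-dimensional non-nilpotent real Lie algebra admitting an abelian complex structure $J$ such that $\dim\mathfrak s'_J=2$, then $(\mathfrak s,J)$ is holomorphically isomorphic to one of the following: \begin{itemize} \item $\mathfrak{aff}(\mathbb R)\times\mathbb R^4$ with its unique (up to equivalence) complex structure; \item $\mathfrak{aff}(\mathbb C)\times\mathbb R^2$ equipped with the product complex structure $J_1\times J_0$, where $J_1$ is the abelian complex structure on $\mathfrak{aff}(\mathbb C)$ given by $J_1e_1=-e_2$, $J_1e_3=e_4$, and $J_0$ is the (unique up to equivalence) complex structure on the abelian Lie algebra $\mathbb R^2$. \end{itemize}
   Context: An abelian complex structure on a real Lie algebra $\mathfrak g$ is a linear endomorphism $J$ with $J^2=-I$ and $[Jx,Jy]=[x,y]$ for all $x,y\in\mathfrak g$. Write $\mathfrak s'=[\mathfrak s,\mathfrak s]$ and $\mathfrak s'_J=\mathfrak s'+J\mathfrak s'$. Two pairs $(\mathfrak g_1,J_1)$, $(\mathfrak g_2,J_2)$ are holomorphically isomorphic if there is a Lie algebra isomorphism $\alpha:\mathfrak g_1\to\mathfrak g_2$ with $J_2\alpha=\alpha J_1$; two complex structures on the same Lie algebra are equivalent if such an automorphism exists. $\mathfrak{aff}(\mathbb R)$ has basis $e_1,e_2$ with $[e_1,e_2]=e_2$; the complex structure on $\mathfrak{aff}(\mathbb R)\times\mathbb R^4$, unique up to equivalence, is the product of $Je_1=e_2$ on $\mathfrak{aff}(\mathbb R)$ with a complex structure on the vector space $\mathbb R^4$. $\mathfrak{aff}(\mathbb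 C)$ is the realification of the Lie algebra of the group of affine motions of $\mathbb C$, with basis $e_1,\dots,e_4$ and nonzero brackets $[e_1,e_3]=e_3$, $[e_1,e_4]=e_4$, $[e_2,e_3]=e_4$, $[e_2,e_4]=-e_3$. $\mathbb R^m$ is the abelian Lie algebra. *)

(* Defs.v *)
From HB Require Import structures.
From mathcomp Require Import all_boot all_order all_algebra.
From mathcomp Require Import reals.
From mathcomp Require Import ring.
Set Implicit Arguments.
Unset Strict Implicit.
Unset Printing Implicit Defensive.
Import GRing.Theory.
Local Open Scope ring_scope.

HB.mixin Record isLieAlgebra (K : fieldType) V of Vector K V := {
  lie : V -> V -> V;
  lie_linearl : forall y, linear (fun x => lie x y);
  lie_linearr : forall x, linear (lie x);
  lie_alt : forall x, lie x x = 0;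
  lie_jacobi : forall x y z,
    lie x (lie y z) + lie y (lie z x) + lie z (lie x y) = 0
}.

#[short(type="lieAlgType")]
HB.structure Definition LieAlgebra (K : fieldType) :=
  { V of isLieAlgebra K V & Vector K V }.

Notation "[ 'Lie' x , y ]" := (lie x y)
  (at level 0, x, y at level 99, format "[ 'Lie'  x ,  y ]") : ring_scope.

Section LieTheory.
Variables (K : fieldType) (g : lieAlgType K).
Implicit Types (x y z : g) (U V W : {vspace g}).

(* The linear span of all brackets [Lie u, v], u in U, v in V; see liev_subP. *)
Definition liev U V : {vspace g} :=
  <<[seq [Lie u, v] | u <- vbasis U, v <- vbasis V]>>%VS.

Lemma memv_lie U V x y : x \in U -> y \in V -> [Lie x, y] \in liev U V.
Proof.
move=> /coord_vbasis-> /coord_vbasis->.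
pose fl (v : g) : {linear g -> g} :=
  HB.pack (fun x : g => [Lie x, v]) (GRing.isLinear.Build K g g _ _ (lie_linearl v)).
pose fr (u : g) : {linear g -> g} :=
  HB.pack (fun v : g => [Lie u, v]) (GRing.isLinear.Build K g g _ _ (lie_linearr u)).
rewrite -[lie _ _]/(fl _ _) linear_sum; apply: memv_suml => i _.
rewrite linearZ /= memvZ // -[lie _ _]/(fr _ _) linear_sum.
apply: memv_suml => j _; rewrite linearZ /= memvZ // memv_span //.
by apply: allpairs_f; apply: mem_nth; rewrite size_tuple.
Qed.

Lemma liev_subP U V W :
  reflect (forall x y, x \in U -> y \in V -> [Lie x, y] \in W)
          (liev U V <= W)%VS.
Proof.
apply: (iffP idP) => [sW x y Ux Vy | sW].
  exact: subvP sW _ (memv_lie Ux Vy).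
by apply/span_subvP=> _ /allpairsP[[u v] /= [Uu Vv ->]]; rewrite sW ?vbasis_mem.
Qed.

Fixpoint lower_central (n : nat) : {vspace g} :=
  if n is m.+1 then liev fullv (lower_central m) else fullv.

Definition nilpotent_lie : Prop := exists n, lower_central n = 0%VS.

Definition derived : {vspace g} := liev fullv fullv.

(* Left-invariant complex structure: J^2 = -1 with vanishing Nijenhuis
   tensor. *)
Definition complex_structure (J : 'End(g)) : Prop :=
  (forall x, J (J x) = - x) /\
  (forall x y, [Lie J x, J y] - [Lie x, y] - J ([Lie J x, y] + [Lie x, J y]) = 0).

Definition abelian_complex_structure (J : 'End(g)) : Prop :=
  (forall x, J (J x) = - x) /\ (forall x y, [Lie J x, J y] = [Lie x, y]).

Definition derivedJ (J : 'End(g)) : {vspace g} := (derived + J @: derived)%VS.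

End LieTheory.

Arguments nilpotent_lie {K} g.
Arguments derived {K} g.
Arguments lower_central {K} g n.

Definition lie_isomorphism (K : fieldType) (g1 g2 : lieAlgType K)
    (alpha : 'Hom(g1, g2)) : Prop :=
  bijective alpha /\ (forall x y, alpha [Lie x, y] = [Lie alpha x, alpha y]).

Definition holomorphically_isomorphic (K : fieldType) (g1 g2 : lieAlgType K)
    (J1 : 'End(g1)) (J2 : 'End(g2)) : Prop :=
  exists alpha : 'Hom(g1, g2),
    lie_isomorphism alpha /\ (forall x, J2 (alpha x) = alpha (J1 x)).

Definition equivalent_cs (K : fieldType) (g : lieAlgType K) (J1 J2 : 'End(g)) :
  Prop := holomorphically_isomorphic J1 J2.

Definition unique_complex_structure (K : fieldType) (g : lieAlgType K)
    (J : 'End(g)) : Prop :=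
  complex_structure J /\
  (forall J' : 'End(g), complex_structure J' -> equivalent_cs J' J).

Section Product.
Variables (K : fieldType) (g1 g2 : lieAlgType K).

Definition lie_prod (x y : g1 * g2) : g1 * g2 := ([Lie x.1, y.1], [Lie x.2, y.2]).

Fact lie_prod_linearl y : linear (fun x => lie_prod x y).
Proof. by move=> a u v; rewrite /lie_prod /= !lie_linearl. Qed.
Fact lie_prod_linearr x : linear (lie_prod x).
Proof. by move=> a u v; rewrite /lie_prod /= !lie_linearr. Qed.
Fact lie_prod_alt x : lie_prod x x = 0.
Proof. by rewrite /lie_prod !lie_alt. Qed.
Fact lie_prod_jacobi x y z :
  lie_prod x (lie_prod y z) + lie_prod y (lie_prod z x)
    + lie_prod z (lie_prod x y) = 0.
Proof. by congr (_, _); rewrite /= lie_jacobi. Qed.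

HB.instance Definition _ := isLieAlgebra.Build K (g1 * g2)%type
  lie_prod_linearl lie_prod_linearr lie_prod_alt lie_prod_jacobi.

Definition prod_endo_fun (J1 : 'End(g1)) (J2 : 'End(g2)) (x : g1 * g2) :
  g1 * g2 := (J1 x.1, J2 x.2).

Fact prod_endo_linear J1 J2 : linear (prod_endo_fun J1 J2).
Proof. by move=> a u v; rewrite /prod_endo_fun /= !linearP. Qed.
HB.instance Definition _ J1 J2 := GRing.isLinear.Build K (g1 * g2)%type
  (g1 * g2)%type _ (prod_endo_fun J1 J2) (prod_endo_linear J1 J2).

Definition prod_cs (J1 : 'End(g1)) (J2 : 'End(g2)) : 'End((g1 * g2)%type) :=
  linfun (prod_endo_fun J1 J2).

Lemma prod_csE J1 J2 x : prod_cs J1 J2 x = (J1 x.1, J2 x.2).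
Proof. exact: lfunE. Qed.

End Product.

Section Abelian.
Variable R : realType.

Definition abel (n : nat) : Type := 'rV[R]_n.
HB.instance Definition _ n := Vector.on (abel n).

Fact abel_linearl n (y : abel n) : linear (fun x : abel n => 0 : abel n).
Proof. by move=> a u v; rewrite scaler0 addr0. Qed.
Fact abel_alt n (x : abel n) : (0 : abel n) = 0.
Proof. by []. Qed.
Fact abel_jacobi n (x y z : abel n) : 0 + 0 + 0 = 0 :> abel n.
Proof. by rewrite !addr0. Qed.
HB.instance Definition _ n := isLieAlgebra.Build R (abel n)
  (lie := fun _ _ => 0)
  (@abel_linearl n) (@abel_linearl n) (@abel_alt n) (@abel_jacobi n).

(* On R^m x R^m = R^(2m): (u, v) |-> (-v, u). *)
Definition std_cs_fun m (x : abel (m + m)) : abel (m + m) :=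
  row_mx (- rsubmx x) (lsubmx x).

Fact std_cs_linear m : linear (@std_cs_fun m).
Proof.
move=> a u v; rewrite /std_cs_fun !linearP /=.
by rewrite -[RHS]/(a *: row_mx _ _ + row_mx _ _) scale_row_mx add_row_mx scalerN -opprD.
Qed.
HB.instance Definition _ m := GRing.isLinear.Build R (abel (m + m))
  (abel (m + m)) _ (@std_cs_fun m) (@std_cs_linear m).

Definition std_cs m : 'End(abel (m + m)) := linfun (@std_cs_fun m).

Lemma std_cs_abelian m : abelian_complex_structure (std_cs m).
Proof.
split=> // x; rewrite !lfunE /= /std_cs_fun row_mxKl row_mxKr.
by rewrite -[RHS]/(- (x : 'rV_(m + m))) -[in RHS](hsubmxK x) opp_row_mx.
Qed.

End Abelian.

Section AffR.
Variable R : realType.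

(* x stands for (x 0 0) e_1 + (x 0 1) e_2. *)
Definition affR : Type := 'rV[R]_2.
HB.instance Definition _ := Vector.on affR.

Definition affR_lie (x y : affR) : affR :=
  \row_k [:: 0; x 0 0 * y 0 1 - x 0 1 * y 0 0]`_k.

Fact affR_linearl y : linear (fun x => affR_lie x y).
Proof.
by move=> a u v; apply/rowP => -[[|[|//]] lt_k]; rewrite !mxE /=; ring.
Qed.
Fact affR_linearr x : linear (affR_lie x).
Proof.
by move=> a u v; apply/rowP => -[[|[|//]] lt_k]; rewrite !mxE /=; ring.
Qed.
Fact affR_alt x : affR_lie x x = 0.
Proof. by apply/rowP => -[[|[|//]] lt_k]; rewrite !mxE /=; ring. Qed.
Fact affR_jacobi x y z :
  affR_lie x (affR_lie y z) + affR_lie y (affR_lie z x)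
    + affR_lie z (affR_lie x y) = 0.
Proof. by apply/rowP => -[[|[|//]] lt_k]; rewrite !mxE /=; ring. Qed.
HB.instance Definition _ := isLieAlgebra.Build R affR
  affR_linearl affR_linearr affR_alt affR_jacobi.

Definition affR_e (i : 'I_2) : affR := delta_mx 0 i.

Lemma affR_bracket : [Lie affR_e 0, affR_e 1] = affR_e 1.
Proof. by apply/rowP => -[[|[|//]] lt_k]; rewrite !mxE /= ?mxE /=; ring. Qed.

Definition affR_cs_fun (x : affR) : affR := \row_k [:: - x 0 1; x 0 0]`_k.
Fact affR_cs_linear : linear affR_cs_fun.
Proof.
by move=> a u v; apply/rowP => -[[|[|//]] lt_k]; rewrite !mxE /=; ring.
Qed.
HB.instance Definition _ :=
  GRing.isLinear.Build R affR affR _ affR_cs_fun affR_cs_linear.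

Definition affR_cs : 'End(affR) := linfun affR_cs_fun.

Lemma affR_csE :
  affR_cs (affR_e 0) = affR_e 1 /\ affR_cs (affR_e 1) = - affR_e 0.
Proof.
by split; rewrite lfunE; apply/rowP => -[[|[|//]] lt_k]; rewrite !mxE //= oppr0.
Qed.

Lemma affR_cs_abelian : abelian_complex_structure affR_cs.
Proof.
split=> [x|x y]; apply/rowP => -[[|[|//]] lt_k]; rewrite !lfunE !mxE //=.
- by congr (- x _ _); apply/val_inj.
- by congr (- x _ _); apply/val_inj.
- by ring.
Qed.

End AffR.

Section AffC.
Variable R : realType.

(* x stands for (x 0 0) e_1 + (x 0 1) e_2 + (x 0 2) e_3 + (x 0 3) e_4. *)
Definition affC : Type := 'rV[R]_4.
HB.instance Definition _ := Vector.on affC.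

(* The bilinear alternating extension of the table of brackets, which is
   recovered as affC_bracket below. *)
Definition affC_lie (x y : affC) : affC :=
  \row_k [:: 0; 0;
    (x 0 0 * y 0 2 - x 0 2 * y 0 0) - (x 0 1 * y 0 3 - x 0 3 * y 0 1);
    (x 0 0 * y 0 3 - x 0 3 * y 0 0) + (x 0 1 * y 0 2 - x 0 2 * y 0 1)]`_k.

Fact affC_linearl y : linear (fun x => affC_lie x y).
Proof.
by move=> a u v; apply/rowP => -[[|[|[|[|//]]]] lt_k]; rewrite !mxE /=; ring.
Qed.
Fact affC_linearr x : linear (affC_lie x).
Proof.
by move=> a u v; apply/rowP => -[[|[|[|[|//]]]] lt_k]; rewrite !mxE /=; ring.
Qed.
Fact affC_alt x : affC_lie x x = 0.
Proof. by apply/rowP => -[[|[|[|[|//]]]] lt_k]; rewrite !mxE /=; ring. Qed.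
Fact affC_jacobi x y z :
  affC_lie x (affC_lie y z) + affC_lie y (affC_lie z x)
    + affC_lie z (affC_lie x y) = 0.
Proof. by apply/rowP => -[[|[|[|[|//]]]] lt_k]; rewrite !mxE /=; ring. Qed.
HB.instance Definition _ := isLieAlgebra.Build R affC
  affC_linearl affC_linearr affC_alt affC_jacobi.

Definition affC_e (i : 'I_4) : affC := delta_mx 0 i.

Lemma affC_bracket :
  [/\ [Lie affC_e 0, affC_e 2] = affC_e 2, [Lie affC_e 0, affC_e 3] = affC_e 3,
      [Lie affC_e 1, affC_e 2] = affC_e 3 & [Lie affC_e 1, affC_e 3] = - affC_e 2]
  /\ [Lie affC_e 0, affC_e 1] = 0 /\ [Lie affC_e 2, affC_e 3] = 0.
Proof.
by (do ![split]); apply/rowP => -[[|[|[|[|//]]]] lt_k];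
  rewrite !mxE /= ?mxE /=; ring.
Qed.

(* J_1 e_1 = - e_2, J_1 e_2 = e_1, J_1 e_3 = e_4, J_1 e_4 = - e_3. *)
Definition affC_cs_fun (x : affC) : affC :=
  \row_k [:: x 0 1; - x 0 0; - x 0 3; x 0 2]`_k.
Fact affC_cs_linear : linear affC_cs_fun.
Proof.
by move=> a u v; apply/rowP => -[[|[|[|[|//]]]] lt_k]; rewrite !mxE /=; ring.
Qed.
HB.instance Definition _ :=
  GRing.isLinear.Build R affC affC _ affC_cs_fun affC_cs_linear.

Definition affC_cs : 'End(affC) := linfun affC_cs_fun.

Lemma affC_csE :
  affC_cs (affC_e 0) = - affC_e 1 /\ affC_cs (affC_e 2) = affC_e 3.
Proof.
by split; rewrite lfunE; apply/rowP => -[[|[|[|[|//]]]] lt_k];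
  rewrite !mxE //= oppr0.
Qed.

Lemma affC_cs_abelian : abelian_complex_structure affC_cs.
Proof.
split=> [x|x y]; apply/rowP => -[[|[|[|[|//]]]] lt_k]; rewrite !lfunE !mxE //=.
all: try by congr (- x _ _); apply/val_inj.
all: by ring.
Qed.

End AffC.

(* Main.v *)
(**
The derived algebra D is nonzero and contained in the complex line
D + JD, and abelianness of J reads [x, Jy] = -[Jx, y].

If D is a line <w>, some y has [y, w] = bw with b <> 0, and the Jacobi identity
for y, Jy, Jw shows [Jw, w] = aw with a <> 0; then e = Jw / a and f = Je span a
copy of aff(R). If D = D + JD, then D is an abelian ideal, the operators ad x
are either zero or invertible on D and therefore commute with J there; so some
e acts on D as the identity and -Je acts as J, and e can be corrected by an
element of D so that [e, Je] = 0.

In both cases e acts as the identity on D, so the common centralizer of e and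
of D is central by the Jacobi identity; it is J-invariant of dimension at least
6 - 2 dim D and supplies the abelian factor. Uniqueness on aff(R) x R^4 is the
first case again, since an integrable complex structure is automatically abelian
when D is a line.
*)
From HB Require Import structures.
Require Import Defs.
From mathcomp Require Import all_boot all_order all_algebra.
From mathcomp Require Import reals.
From mathcomp Require Import ring zify.
Set Implicit Arguments.
Unset Strict Implicit.
Unset Printing Implicit Defensive.
Import Order.TTheory GRing.Theory Num.Theory.
Local Open Scope ring_scope.

(** * Bracket calculus, the lower central series and centralizers *)

Section LieBilinear.
Variables (K : fieldType) (g : lieAlgType K).
Implicit Types x y z : g.

HB.instance Definition _ x := GRing.isLinear.Build K g g _ (lie x) (lie_linearr x).

Lemma lieC x y : [Lie x, y] = - [Lie y, x].
Proof.
have lieDl u v w : [Lie u + v, w] = [Lie u, w] + [Lie v, w].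
  by have := lie_linearl w 1 u v; rewrite !scale1r.
have := lie_alt (x + y); rewrite lieDl !linearD /= !lie_alt addr0 add0r.
by rewrite addrC => /addr0_eq ->.
Qed.

Lemma lieDr x y z : [Lie x, y + z] = [Lie x, y] + [Lie x, z].
Proof. exact: linearD. Qed.
Lemma lieZr a x y : [Lie x, a *: y] = a *: [Lie x, y].
Proof. exact: linearZ. Qed.
Lemma lieNr x y : [Lie x, - y] = - [Lie x, y].
Proof. exact: linearN. Qed.
Lemma lie0r x : [Lie x, 0] = 0.
Proof. exact: linear0. Qed.
Lemma lieDl x y z : [Lie x + y, z] = [Lie x, z] + [Lie y, z].
Proof. by rewrite lieC lieDr opprD -!lieC. Qed.
Lemma lieZl a x y : [Lie a *: x, y] = a *: [Lie x, y].
Proof. by rewrite lieC lieZr -scalerN -lieC. Qed.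
Lemma lieNl x y : [Lie - x, y] = - [Lie x, y].
Proof. by rewrite lieC lieNr -lieC. Qed.

Definition lieE := (lieDl, lieDr, lieZl, lieZr, lieNl, lieNr).

Lemma lie_deriv x y z : [Lie x, [Lie y, z]] = [Lie [Lie x, y], z] + [Lie y, [Lie x, z]].
Proof.
have /eqP := lie_jacobi x y z.
rewrite (lieC z x) lieNr (lieC z) -addrA addr_eq0 => /eqP->.
by rewrite opprD !opprK addrC.
Qed.

Lemma mem_derived x y : [Lie x, y] \in derived g.
Proof. by apply: memv_lie; rewrite memvf. Qed.

(** Otherwise [lower_central g 2] would vanish. *)
Lemma not_nilpotent_derived :
  ~ nilpotent_lie g -> exists y d, d \in derived g /\ [Lie y, d] != 0.
Proof.
move=> nil; have c0 : ~~ (liev fullv (derived g) <= 0)%VS.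
  by apply/negP=> c0; case: nil; exists 2%N; apply/eqP; rewrite -subv0.
have /allPn[_ /allpairsP[[y d] /= [_ dD ->]]] :
    ~~ all (fun v => v \in 0%VS) [seq [Lie u, v] | u <- vbasis {:g}, v <- vbasis (derived g)].
  by apply: contraNN c0 => /allP c0; apply/span_subvP.
by rewrite memv0; exists y, d; rewrite vbasis_mem.
Qed.

(** [ad e] and [ad w] take values in the derived algebra, so each kernel has codimension at most its
    dimension. *)
Lemma dim_centralizer2 (e w : g) :
  exists2 Z : {vspace g},
    (\dim {:g} <= \dim Z + 2 * \dim (derived g))%N &
    forall z, z \in Z = ([Lie e, z] == 0) && ([Lie w, z] == 0).
Proof.
exists (lker (linfun (lie e)) :&: lker (linfun (lie w)))%VS; last first.
  by move=> z; rewrite memv_cap !memv_ker !lfunE.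
have lim x : (\dim (limg (linfun (lie x))) <= \dim (derived g))%N.
  apply: dimvS; apply/subvP=> _ /memv_imgP[u _ ->].
  by rewrite lfunE mem_derived.
have dk x := limg_ker_dim (linfun (lie x)) fullv.
have := dk e; have := dk w; rewrite !capfv => dw de.
have := dimv_sum_cap (lker (linfun (lie e))) (lker (linfun (lie w))).
have := dimvS (subvf (lker (linfun (lie e)) + lker (linfun (lie w)))).
have := lim e; have := lim w; lia.
Qed.

End LieBilinear.

(** * Isomorphisms from injective maps *)

Section HolIso.
Variables (K : fieldType) (g1 g2 : lieAlgType K) (J1 : 'End(g1)) (J2 : 'End(g2)).

(** Maps are easier to define on the model [g1], by coordinates; the isomorphism sought is the
    inverse. *)
Lemma hol_iso_of_injective (b : g1 -> g2) :
  linear b -> (forall x, b x = 0 -> x = 0) -> \dim {:g1} = \dim {:g2} ->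
  (forall x y, b [Lie x, y] = [Lie b x, b y]) ->
  (forall x, b (J1 x) = J2 (b x)) -> holomorphically_isomorphic J2 J1.
Proof.
move=> b_lin b_inj eq_dim b_lie bJ.
pose bl : {linear g1 -> g2} := HB.pack b (GRing.isLinear.Build K g1 g2 _ b b_lin).
pose f := linfun bl.
have fE x : f x = b x by rewrite lfunE.
have kf : lker f == 0%VS.
  rewrite -subv0; apply/subvP=> x; rewrite memv_ker memv0 fE => /eqP/b_inj->.
  exact: eqxx.
have fK := lker0_lfunK kf.
have fVK : cancel f^-1%VF f.
  move=> y; apply: limg_lfunVK.
  suff -> : limg f = fullv by rewrite memvf.
  by apply/eqP; rewrite eqEdim subvf /= limg_dim_eq ?eq_dim // (eqP kf) capv0.
exists f^-1%VF; split; first split.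
- by exists f.
- by move=> x y; rewrite -{1}(fVK x) -{1}(fVK y) !fE -b_lie -fE fK.
- by move=> x; apply: (can_inj fK); rewrite fVK fE bJ -fE fVK.
Qed.

End HolIso.

(** * Complex bases of [J]-invariant subspaces *)

Section ComplexFrame.
Variables (R : realType) (V : vectType R) (J : 'End(V)).
Hypothesis JJ : forall x, J (J x) = - x.

(** Multiplying by the conjugate [a - b J] puts [(a^2 + b^2) z] in [S]; over the reals the factor
    vanishes only if [a = b = 0]. *)
Lemma J_indep (S : {vspace V}) z a b :
  (forall x, x \in S -> J x \in S) -> z \notin S -> a *: z + b *: J z \in S ->
  a = 0 /\ b = 0.
Proof.
move=> SJ zS yS; have := memvB (memvZ a yS) (memvZ b (SJ _ yS)).
have -> : J (a *: z + b *: J z) = a *: J z - b *: z.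
  by rewrite linearD !linearZ /= JJ scalerN.
rewrite !scalerDr !scalerN !scalerA.
rewrite (_ : _ - _ = (a ^+ 2 + b ^+ 2) *: z); last first.
  rewrite opprD opprK (mulrC b a) [- _ + _]addrC addrACA subrr addr0.
  by rewrite -scalerDl.
move=> cS; have : a ^+ 2 + b ^+ 2 == 0.
  apply: contraNT zS => c0; rewrite -[z](scalerK c0); exact: memvZ.
by rewrite paddr_eq0 ?sqr_ge0 // !sqrf_eq0 => /andP[/eqP-> /eqP->].
Qed.

Lemma J_free w a b : w != 0 -> a *: w + b *: J w = 0 -> a = 0 /\ b = 0.
Proof.
move=> w0 ab; apply: (@J_indep 0%VS w); rewrite ?memv0 ?ab // => x.
by rewrite !memv0 => /eqP->; rewrite linear0.
Qed.

(** The span [S] of the pairs already chosen is [J]-invariant and too small to contain [Z], so any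
    [z] of [Z] outside [S] gives the next pair. *)
Lemma complex_seq m (Z : {vspace V}) :
  (forall x, x \in Z -> J x \in Z) -> (m + m <= \dim Z)%N ->
  exists u : seq V, [/\ size u = m, {subset u <= Z} & free (u ++ map J u)].
Proof.
move=> ZJ; elim: m => [|m IHm] dZ.
  by exists [::]; split=> //; rewrite nil_free.
have [|u [su uZ fu]] := IHm; first by lia.
pose S := <<u ++ map J u>>%VS.
have SJ x : x \in S -> J x \in S.
  move=> xS; have : J x \in (J @: S)%VS by apply: memv_img.
  rewrite limg_span; move: (J x); apply/subvP/span_subvP=> y /mapP[v].
  rewrite mem_cat => /orP[vu ->|/mapP[v' v'u ->] ->].
    by apply: memv_span; rewrite mem_cat map_f ?orbT.
  by rewrite JJ memvN memv_span // mem_cat v'u.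
have /subvPn[z zZ zS] : ~~ (Z <= S)%VS.
  apply/negP => /dimvS; have := dim_span (u ++ map J u).
  rewrite size_cat size_map su -/S; lia.
exists (z :: u); split=> [|x|]; first by rewrite /= su.
  by rewrite inE => /orP[/eqP-> //|/uZ].
have /perm_free-> : perm_eq ((z :: u) ++ map J (z :: u)) (z :: J z :: u ++ map J u).
  by rewrite /= perm_cons -(cat1s (J z) (map J u)) perm_catCA.
rewrite !free_cons fu andbT; apply/andP; split.
  apply/negP; rewrite span_cons => /memv_addP[_ /vlineP[c ->] [s sS zE]].
  have [] := @J_indep S z 1 (- c) SJ zS; last by move/eqP; rewrite oner_eq0.
  by rewrite scale1r scaleNr {1}zE addrAC subrr add0r.
apply/negP=> JzS; have [] := @J_indep S z 0 1 SJ zS.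
  by rewrite scale0r add0r scale1r.
by move=> _ /eqP; rewrite oner_eq0.
Qed.

Lemma complex_frame m (Z : {vspace V}) :
  (forall x, x \in Z -> J x \in Z) -> (m + m <= \dim Z)%N ->
  exists p : 'Hom(abel R (m + m), V),
    [/\ forall x, p x = 0 -> x = 0, forall x, p x \in Z
      & forall x, p (std_cs R m x) = J (p x)].
Proof.
move=> ZJ /(complex_seq ZJ)[u [su uZ fu]].
have sX : size (u ++ map J u) == (m + m)%N by rewrite size_cat size_map su.
pose X := Tuple sX.
pose pf (x : abel R (m + m)) : V := \sum_i (x : 'rV_(m + m)) 0 i *: X`_i.
have pf_lin : linear pf.
  move=> a x y; rewrite /pf scaler_sumr -big_split /=; apply: eq_bigr => i _.
  by rewrite !mxE scalerDl scalerA.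
pose pl : {linear abel R (m + m) -> V} :=
  HB.pack pf (GRing.isLinear.Build R (abel R (m + m)) V _ pf pf_lin).
exists (linfun pl); split=> x; rewrite !lfunE /=.
- move=> x0; apply/rowP => i; rewrite mxE.
  by move/freeP: (fu : free X) => /(_ _ x0).
- apply: memv_suml => i _; apply: memvZ.
  have : X`_i \in u ++ map J u by apply: mem_nth; rewrite (eqP sX).
  by rewrite mem_cat => /orP[/uZ //|/mapP[v /uZ vZ ->]]; apply: ZJ.
have pfE (y : abel R (m + m)) : pf y =
    \sum_(i < m) (lsubmx y 0 i *: u`_i + rsubmx y 0 i *: J u`_i).
  rewrite /pf big_split_ord big_split /=.
  congr (_ + _); apply: eq_bigr => i _; rewrite mxE nth_cat /= su.
    by rewrite ltn_ord.
  by rewrite ltnNge leq_addr addKn (nth_map 0) // su.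
rewrite !pfE raddf_sum; apply: eq_bigr => i _ /=.
rewrite /std_cs_fun row_mxKl row_mxKr mxE linearD !linearZ /= JJ.
by rewrite scalerN scaleNr addrC.
Qed.

End ComplexFrame.

(** * Dimensions of the models *)

Lemma dim_affR (R : realType) : \dim {:affR R} = 2%N.
Proof. by rewrite dimvf; apply: dim_matrix. Qed.

Lemma dim_affC (R : realType) : \dim {:affC R} = 4%N.
Proof. by rewrite dimvf; apply: dim_matrix. Qed.

Lemma dim_abel (R : realType) n : \dim {:abel R n} = n.
Proof. by rewrite dimvf; apply: etrans (dim_matrix _ 1 n) (mul1n n). Qed.

Lemma dim_prod_vect (K : fieldType) (V W : vectType K) :
  \dim {:(V * W)%type} = (\dim {:V} + \dim {:W})%N.
Proof. by rewrite !dimvf. Qed.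

(** * Abelian complex structures and the central factor *)

Section AbelianCS.
Variables (R : realType) (g : lieAlgType R) (J : 'End(g)).
Implicit Types x y z w d e : g.

Lemma abelian_cs_integrable : abelian_complex_structure J -> complex_structure J.
Proof.
case=> JJ Jlie; split=> // x y; rewrite Jlie subrr -(Jlie (J x) y) JJ lieNl.
by rewrite addNr linear0 oppr0 addr0.
Qed.

(* If all brackets lie on a line [<[w]>], the integrability condition reads
   [c w = d J w], which forces both sides to vanish. *)
Lemma cs_abelian_of_line w :
  w != 0 -> (forall x y, [Lie x, y] \in <[w]>%VS) -> complex_structure J ->
  abelian_complex_structure J.
Proof.
move=> w0 lie_w [JJ nij]; split=> // x y.
have /vlineP[a aE] : [Lie J x, J y] - [Lie x, y] \in <[w]>%VS by rewrite memvB.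
have /vlineP[b bE] : [Lie J x, y] + [Lie x, J y] \in <[w]>%VS by rewrite memvD.
have := nij x y; rewrite aE bE linearZ /= -scaleNr => /(J_free JJ w0)[a0 _].
by apply/eqP; rewrite -subr_eq0 aE a0 scale0r.
Qed.

Hypothesis Jab : abelian_complex_structure J.
Let JJ : forall x, J (J x) = - x := proj1 Jab.

Lemma lie_Jr x y : [Lie x, J y] = - [Lie J x, y].
Proof. by case: Jab => _ Jlie; rewrite -Jlie JJ lieNr. Qed.

(* [ad e] being the identity on the derived algebra, Jacobi makes every
   element commuting with [e] and with the derived algebra central. *)
Lemma central_frame e w m :
  (forall d, d \in derived g -> [Lie e, d] = d) ->
  (forall z, [Lie w, z] = 0 -> forall d, d \in derived g -> [Lie d, z] = 0) ->
  (\dim {:g} = 2 * \dim (derived g) + (m + m))%N ->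
  exists p : 'Hom(abel R (m + m), g),
    [/\ forall u, p u = 0 -> u = 0, forall u y, [Lie p u, y] = 0
      & forall u, p (std_cs R m u) = J (p u)].
Proof.
move=> eD wD dg; have [Z dZ ZE] := dim_centralizer2 e w.
have Zc z y : z \in Z -> [Lie z, y] = 0.
  rewrite ZE => /andP[/eqP ez /eqP wz].
  (* [[z, y] = [e, [z, y]] = [z, [e, y]]], and [z] commutes with [[e, y]], an element of the derived
     algebra. *)
  rewrite -(eD _ (mem_derived z y)) lie_deriv ez.
  rewrite lieC lie0r oppr0 add0r lieC.
  by rewrite (wD z wz) ?mem_derived ?oppr0.
have ZJ z : z \in Z -> J z \in Z.
  move=> /Zc zc; have Jzc x : [Lie J z, x] = 0.
    by apply/eqP; rewrite -oppr_eq0 -lie_Jr zc.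
  by rewrite ZE ![[Lie _, J z]]lieC !Jzc oppr0 eqxx.
have [|p [p0 pZ pJ]] := @complex_frame R g J JJ m Z ZJ; first by lia.
by exists p; split=> // x y; apply/Zc/pZ.
Qed.

(** * The case of a derived line *)

Lemma hol_iso_affR m w y :
  w != 0 -> (forall x y, [Lie x, y] \in <[w]>%VS) -> [Lie y, w] != 0 ->
  \dim {:g} = (2 + (m + m))%N ->
  holomorphically_isomorphic J (prod_cs (affR_cs R) (std_cs R m)).
Proof.
move=> w0 lie_w yw dg.
have lie_wE u v : exists a, [Lie u, v] = a *: w by apply/vlineP/lie_w.
have [a aE] := lie_wE (J w) w.
have a0 : a != 0.
  apply/negP=> /eqP a0; rewrite {}a0 scale0r in aE.
  have [b bE] := lie_wE y w; have [c cE] := lie_wE (J y) w.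
  have [d dE] := lie_wE y (J y).
  have b0 : b != 0 by apply: contraNneq yw => b0; rewrite bE b0 scale0r.
  (* If [[J w, w] = 0], this identity becomes [b^2 w = - c^2 w], against [b <> 0]. *)
  have := lie_deriv y (J y) (J w).
  have -> : [Lie J y, J w] = b *: w by rewrite lie_Jr JJ lieNl opprK.
  have -> : [Lie y, J w] = - (c *: w) by rewrite lie_Jr cE.
  rewrite dE !lieE bE cE [[Lie w, J w]]lieC aE oppr0 scaler0 add0r !scalerA.
  move/eqP; rewrite -addr_eq0 -scalerDl scaler_eq0 (negPf w0) orbF.
  by rewrite paddr_eq0 ?sqr_ge0 // mulf_eq0 (negPf b0).
pose e := a^-1 *: J w.
have ew : [Lie e, w] = w by rewrite lieZl aE scalerK.
have derE : derived g = <[w]>%VS.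
  apply/eqP; rewrite eqEsubv; apply/andP; split.
    by apply/liev_subP => u v _ _; apply: lie_w.
  by rewrite -memvE -ew mem_derived.
have [|z wz|//|p [p0 pc pJ]] := @central_frame e w m.
- by move=> d; rewrite derE => /vlineP[k ->]; rewrite lieZr ew.
- by move=> d; rewrite derE => /vlineP[k ->]; rewrite lieZl wz scaler0.
- by rewrite derE dim_vline w0 dg.
have pc' u v : [Lie v, p u] = 0 by rewrite lieC pc oppr0.
pose f := J e.
have fE : f = - a^-1 *: w by rewrite /f linearZ /= JJ scalerN scaleNr.
have ef : [Lie e, f] = f by rewrite fE lieZr ew.
have f0 : f != 0 by rewrite fE scaler_eq0 oppr_eq0 invr_eq0 negb_or a0.
have fe : [Lie f, e] = - f by rewrite lieC ef.
have Je : J e = f by [].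
have Jf : J f = - e := JJ e.
clearbody f; clearbody e.
pose b (x : affR R * abel R (m + m)) := x.1 0 0 *: e + x.1 0 1 *: f + p x.2.
(* Brackets with [e] and [f] recover the affine coordinates of [u], which gives injectivity as well
   as the bracket identity. *)
have beb u : [Lie e, b u] = u.1 0 1 *: f.
  by rewrite !lieE ef lie_alt pc' scaler0 add0r addr0.
have bfb u : [Lie f, b u] = - (u.1 0 0 *: f).
  by rewrite !lieE fe lie_alt pc' scaler0 scalerN !addr0.
apply: (@hol_iso_of_injective _ _ _ _ _ b).
- move=> k x z; rewrite /b !mxE linearP /= !scalerDl !scalerDr !scalerA.
  by rewrite (addrACA (_ *: e)) (addrACA (_ *: e + _)).
- move=> [x1 x2] bx0; have /eqP := beb (x1, x2); have /eqP := bfb (x1, x2).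
  rewrite bx0 !lie0r ![0 == _]eq_sym oppr_eq0 !scaler_eq0 (negPf f0) !orbF /=.
  move=> /eqP x10 /eqP x11; move: bx0.
  rewrite /b /= x10 x11 !scale0r !add0r => /p0->; congr (_, _).
  apply/rowP => -[[|[|//]] lt_k]; rewrite mxE; [rewrite -[RHS]x10|rewrite -[RHS]x11].
    by congr (x1 _ _); apply: val_inj.
  by congr (x1 _ _); apply: val_inj.
- by rewrite dim_prod_vect dim_affR dim_abel dg.
- move=> x z; rewrite {2}/b !lieDl !lieZl pc addr0 beb bfb.
  rewrite /b /= linear0 !mxE /= scale0r add0r addr0.
  rewrite scalerBl !scalerN !scalerA; exact: erefl.
- move=> x; rewrite prod_csE /b /= /affR_cs lfunE /= !mxE /= pJ !linearD !linearZ /=.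
  by rewrite Je Jf scalerN scaleNr [- _ + _]addrC.
Qed.

(** * The case of a [J]-invariant derived plane *)

Hypothesis DJ : forall d, d \in derived g -> J d \in derived g.
Hypothesis dimD : \dim (derived g) = 2%N.

Lemma derived_span w d :
  w \in derived g -> w != 0 -> d \in derived g -> exists a b, d = a *: w + b *: J w.
Proof.
move=> wD w0 dD.
have wJ : w \notin <[J w]>%VS.
  apply/negP=> /vlineP[c /eqP]; rewrite -subr_eq0 -scaleNr -{1}[w]scale1r.
  by move=> /eqP/(J_free JJ w0)[/eqP]; rewrite oner_eq0.
have Jw0 : J w != 0.
  by apply: contraNneq w0 => Jw0; rewrite -oppr_eq0 -JJ Jw0 linear0.
have sD : (<<[:: w; J w]>> <= derived g)%VS.
  by rewrite span_cons span_seq1 subv_add -!memvE wD DJ.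
have fw : free [:: w; J w] by rewrite free_cons span_seq1 wJ seq1_free.
have /eqP eD : <<[:: w; J w]>>%VS == derived g.
  by rewrite eqEdim sD dimD (eqP (fw : \dim _ == _)).
move: dD; rewrite -eD span_cons span_seq1.
by move=> /memv_addP[_ /vlineP[a ->] [_ /vlineP[b ->] ->]]; exists a, b.
Qed.

(* If [u = [w, J w]] were nonzero, then [u, J u] would be a nonzero multiple of
   [u]; the derivations [ad x] then preserve the line [<[u]>], hence commute on
   it, and the derived algebra would commute with [u]. *)
Lemma derived_J_comm w : w \in derived g -> [Lie w, J w] = 0.
Proof.
move=> wD; set u := [Lie w, J w]; have [//|u0] := eqVneq u 0.
have uD : u \in derived g by apply: mem_derived.
have w0 : w != 0 by apply: contraNneq u0 => w0; rewrite /u w0 linear0 lie0r.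
have [c c0 cE] : exists2 c, c != 0 & [Lie u, J u] = c *: u.
  have [a [b uE]] := derived_span wD w0 uD.
  (* For [u = a w + b J w], [[u, J u] = (a^2 + b^2) [w, J w]]. *)
  exists (a ^+ 2 + b ^+ 2).
    apply: contraNneq u0 => /eqP; rewrite paddr_eq0 ?sqr_ge0 // !sqrf_eq0.
    by move=> /andP[/eqP a0 /eqP b0]; rewrite uE a0 b0 !scale0r addr0.
  have Jw : [Lie J w, w] = - u by rewrite lieC.
  rewrite uE linearD !linearZ /= JJ !lieE !lie_alt -/u Jw oppr0 !scaler0 addr0 add0r.
  by rewrite !scalerN !opprK !scalerA -uE -scalerDl.
have line x : exists a, [Lie x, u] = a *: u.
  have [a [b xE]] := derived_span uD u0 (mem_derived x u).
  have [p [q JxE]] := derived_span uD u0 (mem_derived (J x) u).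
  (* Comparing the coefficients of [J u] gives [c b = 0]. *)
  have := lie_deriv x u (J u); rewrite cE lieZr (lie_Jr x u) JxE xE.
  rewrite lieNr !lieE cE !lie_alt !scaler0 add0r addr0 scalerDr !scalerA (mulrC a).
  move=> /addrI/eqP; rewrite -addr_eq0 addrC => /eqP/(J_free JJ u0)[_ /eqP].
  rewrite mulf_eq0 (negPf c0) /= => /eqP b0.
  by exists a; rewrite b0 scale0r addr0.
have : (derived g <= lker (linfun (lie u)))%VS.
  apply/liev_subP=> x y _ _; rewrite memv_ker lfunE /= lieC oppr_eq0.
  have [a aE] := line x; have [b bE] := line y.
  have := lie_deriv x y u; rewrite aE bE !lieE aE bE !scalerA mulrC.
  by rewrite -[LHS]add0r => /addIr<-.
move/subvP=> /(_ _ (DJ uD)); rewrite memv_ker lfunE /= cE scaler_eq0.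
by rewrite (negPf c0) (negPf u0).
Qed.

Lemma derived_comm d d' : d \in derived g -> d' \in derived g -> [Lie d, d'] = 0.
Proof.
move=> dD d'D; have [->|d0] := eqVneq d 0; first by rewrite lieC lie0r oppr0.
have [a [b ->]] := derived_span dD d0 d'D.
by rewrite !lieE lie_alt derived_J_comm // !scaler0 addr0.
Qed.

Lemma ad_comm x y d : d \in derived g -> [Lie x, [Lie y, d]] = [Lie y, [Lie x, d]].
Proof. by move=> dD; rewrite lie_deriv derived_comm ?mem_derived // add0r. Qed.

(** Both sides equal [-[x, [J y, d]]]. Once some [ad y] is injective on the plane, this says that
    [ad x] commutes with [J] there. *)
Lemma ad_ad_J x y d : d \in derived g -> [Lie y, [Lie x, J d]] = [Lie y, J [Lie x, d]].
Proof.
by move=> dD; rewrite ad_comm ?DJ // !lie_Jr lieNr ad_comm.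
Qed.

(* A kernel vector [k] of [ad y] would make [ad y] nilpotent on the plane
   spanned by [k] and [J k], which [ad_ad_J] excludes. *)
Lemma ad_inj y d0 : d0 \in derived g -> [Lie y, d0] != 0 ->
  forall d, d \in derived g -> [Lie y, d] = 0 -> d = 0.
Proof.
move=> d0D yd0 k kD yk; have [//|k0] := eqVneq k 0; case/negP: yd0.
have [a [b abE]] := derived_span kD k0 (mem_derived y (J k)).
suff yJk : [Lie y, J k] = 0.
  have [p [q ->]] := derived_span kD k0 d0D.
  by rewrite !lieE yk yJk !scaler0 addr0.
have := ad_ad_J y y kD; rewrite yk linear0 lie0r abE !lieE yk abE scaler0 add0r.
move/eqP; rewrite scaler_eq0 => /orP[/eqP b0|/eqP//].
(* Now [[y, J k] = a k], and the identity at [J k] reads [0 = a^2 k]. *)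
have := ad_ad_J y y (DJ kD).
rewrite JJ lieNr yk oppr0 lie0r abE b0 scale0r addr0 linearZ /= lieZr abE b0.
rewrite scale0r addr0 scalerA => /esym/eqP; rewrite scaler_eq0 (negPf k0) orbF.
by rewrite mulf_eq0 orbb => /eqP->; rewrite scale0r.
Qed.

Lemma hol_iso_affC m y d0 :
  d0 \in derived g -> [Lie y, d0] != 0 -> \dim {:g} = (4 + (m + m))%N ->
  holomorphically_isomorphic J (prod_cs (affC_cs R) (std_cs R m)).
Proof.
move=> d0D yd0 dg.
have adJ x d : d \in derived g -> [Lie x, J d] = J [Lie x, d].
  move=> dD; apply/eqP; rewrite -subr_eq0; apply/eqP.
  apply: (ad_inj d0D yd0); first by rewrite memvB ?DJ ?mem_derived.
  by rewrite lieDr lieNr ad_ad_J // subrr.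
have [w wD w0] : exists2 w, w \in derived g & w != 0.
  by exists d0 => //; apply: contraNneq yd0 => ->; rewrite lie0r.
(* With [ad y = a + J b] on the derived plane, [ad (J y) = b - J a]. *)
have [e0 e0w] : exists e0, [Lie e0, w] = w.
  have [a [b ywE]] := derived_span wD w0 (mem_derived y w).
  have Jyw : [Lie J y, w] = b *: w - a *: J w.
    apply: oppr_inj; rewrite -lie_Jr adJ // ywE linearD !linearZ /= JJ.
    by rewrite scalerN opprB scalerN.
  (* The operator [a (a + J b) + b (b - J a)] is the scalar [a^2 + b^2]. *)
  exists ((a ^+ 2 + b ^+ 2)^-1 *: (a *: y + b *: J y)).
  rewrite !lieE ywE Jyw !(scalerDr a, scalerDr b) scalerN !scalerA (mulrC b a).
  rewrite addrACA subrr addr0 -scalerDl -!expr2.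
  apply: scalerK; apply: contraNneq yd0 => /eqP.
  rewrite paddr_eq0 ?sqr_ge0 // !sqrf_eq0 => /andP[/eqP a0 /eqP b0].
  have [p [q ->]] := derived_span wD w0 d0D.
  by rewrite !lieE adJ // ywE a0 b0 !scale0r addr0 !linear0 addr0.
have e0D d : d \in derived g -> [Lie e0, d] = d.
  by move=> /(derived_span wD w0)[p [q ->]]; rewrite !lieE adJ // e0w.
(* Adding [v] to [e0] adds [2 J v] to [[e0, J e0]]. *)
have [e eD eJe] : exists2 e, forall d, d \in derived g -> [Lie e, d] = d
                          & [Lie e, J e] = 0.
  have [v vD Jv] : exists2 v, v \in derived g & J v = - (2%:R^-1 *: [Lie e0, J e0]).
    exists (2%:R^-1 *: J [Lie e0, J e0]); first by rewrite memvZ ?DJ ?mem_derived.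
    by rewrite linearZ /= JJ scalerN.
  exists (e0 + v) => [d dD|]; first by rewrite lieDl e0D // derived_comm ?addr0.
  rewrite linearD /= !lieE (derived_J_comm vD) addr0 [[Lie v, _]]lie_Jr.
  rewrite [[Lie J v, _]]lieC opprK (e0D (J v)) ?DJ // Jv -addrA -opprD -scalerDl.
  by rewrite (_ : _ + _ = 1) ?scale1r ?subrr //; field.
have [|z wz|//|p [p0 pc pJ]] := @central_frame e w m.
- exact: eD.
(* [ad z] commutes with [J] on the plane, so if it kills [w] it kills [J w] too. *)
- move=> d /(derived_span wD w0)[a [b ->]].
  rewrite !lieE wz [[Lie J w, z]]lieC adJ // [[Lie z, w]]lieC wz.
  by rewrite !(linear0, oppr0, scaler0, addr0).
- by rewrite dimD dg.
have pc' u v : [Lie v, p u] = 0 by rewrite lieC pc oppr0.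
(* The sign follows the model, where [J_1 e_1 = - e_2]. *)
have [f [Jf Je]] : exists f, J f = e /\ J e = - f.
  by exists (- J e); rewrite linearN /= JJ !opprK.
have ef : [Lie e, f] = 0 by apply: oppr_inj; rewrite -lieNr -Je eJe oppr0.
have fe : [Lie f, e] = 0 by rewrite lieC ef oppr0.
have ew := eD w wD; have eJw := eD _ (DJ wD).
have fw : [Lie f, w] = J w by rewrite -[f]opprK -Je lieNl -lie_Jr.
have fJw : [Lie f, J w] = - w by rewrite lie_Jr Jf ew.
have wJw := derived_J_comm wD.
have Jww : [Lie J w, w] = 0 by rewrite lieC wJw oppr0.
(* Collecting plane coordinates in [L], soon opaque, reduces the bracket identity to scalar
   identities. *)
pose L a b := a *: w + b *: J w.
have LD a b a' b' : L a b + L a' b' = L (a + a') (b + b').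
  by rewrite /L !scalerDl addrACA.
have LZ k a b : k *: L a b = L (k * a) (k * b).
  by rewrite /L scalerDr !scalerA.
have L0 a b : 0 = L a b -> a = 0 /\ b = 0 by move/esym/(J_free JJ w0).
have LE a b : L a b = a *: w + b *: J w by [].
clearbody L.
pose b (x : affC R * abel R (m + m)) :=
  (x.1 0 0 *: e + x.1 0 1 *: f) + L (x.1 0 2) (x.1 0 3) + p x.2.
have beb u : [Lie e, b u] = L (u.1 0 2) (u.1 0 3).
  by rewrite /b !LE !lieE ew eJw ef pc' lie_alt !scaler0 !add0r addr0.
have bfb u : [Lie f, b u] = L (- u.1 0 3) (u.1 0 2).
  by rewrite /b !LE !lieE fw fJw fe pc' lie_alt !scaler0 !add0r addr0 scalerN scaleNr addrC.
have bwb u : [Lie w, b u] = L (- u.1 0 0) (- u.1 0 1).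
  rewrite /b !LE !lieE lie_alt wJw pc' [[Lie w, e]]lieC ew [[Lie w, f]]lieC fw.
  by rewrite !scaler0 !addr0 !scalerN -!scaleNr.
have bJwb u : [Lie J w, b u] = L (u.1 0 1) (- u.1 0 0).
  rewrite /b !LE !lieE lie_alt Jww pc' [[Lie J w, e]]lieC eJw [[Lie J w, f]]lieC fJw.
  by rewrite !scaler0 !addr0 opprK !scalerN -!scaleNr addrC.
apply: (@hol_iso_of_injective _ _ _ _ _ b).
- move=> k x z; rewrite /b !mxE linearP /= !scalerDr LZ -addrA.
  rewrite -LD !scalerDl !scalerA (addrACA (_ *: e)).
  by rewrite [RHS]addrACA [X in _ = X + _]addrACA addrA.
- move=> [x1 x2] bx0; have := beb (x1, x2); have := bwb (x1, x2).
  rewrite bx0 !lie0r /= => /L0[/eqP + /eqP +] /L0[x12 x13].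
  rewrite !oppr_eq0 => /eqP x10 /eqP x11; move: bx0.
  rewrite /b LE /= x10 x11 x12 x13 !scale0r !add0r => /p0->; congr (_, _).
  apply/rowP => -[[|[|[|[|//]]]] lt_k]; rewrite mxE;
    [rewrite -[RHS]x10|rewrite -[RHS]x11|rewrite -[RHS]x12|rewrite -[RHS]x13];
    by congr (x1 _ _); apply: val_inj.
- by rewrite dim_prod_vect dim_affC dim_abel dg.
- move=> x z; rewrite {2}/b LE !lieDl !lieZl pc addr0 beb bfb bwb bJwb.
  rewrite !LZ !LD /b /= linear0 !mxE /= !scale0r !add0r addr0.
  by congr L; ring.
- move=> x; rewrite prod_csE /b /= /affC_cs lfunE /= !mxE /= pJ.
  rewrite !LE !linearD !linearZ /= Je Jf JJ !scalerN !scaleNr.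
  by congr (_ + _ + _); exact: addrC.
Qed.

End AbelianCS.

(** * Uniqueness on the models and the classification *)

Lemma prod_cs_abelian (K : fieldType) (g1 g2 : lieAlgType K)
    (J1 : 'End(g1)) (J2 : 'End(g2)) :
  abelian_complex_structure J1 -> abelian_complex_structure J2 ->
  abelian_complex_structure (prod_cs J1 J2).
Proof.
move=> [JJ1 lie1] [JJ2 lie2]; split=> [x|x y]; rewrite !prod_csE /=.
  by rewrite JJ1 JJ2.
by congr (_, _); rewrite /= ?lie1 ?lie2.
Qed.

(** A complex frame of the whole space is the required isomorphism, all brackets being zero. *)
Lemma std_cs_unique (R : realType) m : unique_complex_structure (std_cs R m).
Proof.
split=> [|J' [JJ _]]; first exact/abelian_cs_integrable/std_cs_abelian.
have [||p [p0 _ pJ]] := @complex_frame R _ J' JJ m fullv.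
- by move=> x _; rewrite memvf.
- by rewrite dim_abel.
apply: (@hol_iso_of_injective _ _ _ _ _ p) => //; first exact: linearP.
by move=> x y; rewrite linear0.
Qed.

Lemma affR_std_cs_unique (R : realType) m :
  unique_complex_structure (prod_cs (affR_cs R) (std_cs R m)).
Proof.
split=> [|J' csJ'].
  by apply/abelian_cs_integrable/prod_cs_abelian; [apply: affR_cs_abelian | apply: std_cs_abelian].
pose e i : affR R * abel R (m + m) := (affR_e R i, 0).
have e0 : e 1 != 0.
  apply/eqP=> -[/rowP/(_ 1)/eqP]; rewrite !mxE eqxx; apply/negP; exact: oner_neq0.
have lie_e x y : [Lie x, y] \in <[e 1]>%VS.
  apply/vlineP; exists (x.1 0 0 * y.1 0 1 - x.1 0 1 * y.1 0 0).
  congr (_, _); last by rewrite /= scaler0.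
  by apply/rowP => -[[|[|//]] lt_k]; rewrite !mxE /= ?mulr0 ?mulr1.
apply: (@hol_iso_affR _ _ _ (cs_abelian_of_line e0 lie_e csJ') m (e 1) (e 0)) => //.
  by rewrite [X in X != 0](_ : _ = e 1) //; congr (_, _); apply: affR_bracket.
by rewrite dim_prod_vect dim_affR dim_abel.
Qed.

Theorem theorem4p1 (R : realType) (s : lieAlgType R) (J : 'End(s)) :
  \dim {:s} = 6%N ->
  ~ nilpotent_lie s ->
  abelian_complex_structure J ->
  \dim (derivedJ J) = 2%N ->
  (unique_complex_structure (prod_cs (affR_cs R) (std_cs R 2)) /\
   holomorphically_isomorphic J (prod_cs (affR_cs R) (std_cs R 2)))
  \/
  (unique_complex_structure (std_cs R 1) /\
   holomorphically_isomorphic J (prod_cs (affC_cs R) (std_cs R 1))).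
Proof.
move=> dims /not_nilpotent_derived[y [d [dD yd]]] Jab dimDJ.
have sD : (derived s <= derivedJ J)%VS by apply: addvSl.
(* Either the derived algebra fills [derivedJ J], hence is [J]-invariant, or it is the line through
   [d]. *)
have [dimD|dimD] := leqP 2 (\dim (derived s)).
  have eD : derived s = derivedJ J by apply/eqP; rewrite eqEdim sD dimDJ.
  right; split; first exact: std_cs_unique.
  apply: (@hol_iso_affC _ _ _ Jab _ _ 1 y d) => //; last by rewrite eD.
  move=> x xD; rewrite [in X in _ \in X]eD /derivedJ.
  by apply: (subvP (addvSr _ _)); apply: memv_img.
left; split; first exact: affR_std_cs_unique.
have d0 : d != 0 by apply: contraNneq yd => ->; rewrite lie0r.
have eD : <[d]>%VS = derived s.
  by apply/eqP; rewrite eqEdim -memvE dD dim_vline d0.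
apply: (@hol_iso_affR _ _ _ Jab 2 d y) => // u v.
by rewrite eD mem_derived.
Qed.
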